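(* Let $G=(V,E)$ be a locally path-bounded digraph. Then $G$ has a unique $\gamma$-function with an associated counter function; that is, there is exactly one function $\gamma\colon V\to\mathbb{Z}^0\cup\{\infty\}$ for which there exist an infinite well-ordered set $J$ and a function $c\colon V^f\to J$ (where $V^f=\{u\in V:\gamma(u)<\infty\}$) such that $\gamma$ is a $\gamma$-function on $G$ with counter function $c$. Moreover, for every $u\in V^f$, $\gamma(u)$ does not exceed the length of a longest path in $G$ emanating from $u$.
   Context: $\mathbb{Z}^0$ denotes the set of nonnegative integers. Digraphs $G=(V,E)$, $E\subseteq V\times V$, may be finite or infinite and may contain cycles and loops. For $u\in V$, the set of followers of $u$ is $F(u)=\{v\in V:(u,v)\in E\}$ (possibly infinite or empty). A walk is a sequence of vertices $u_1,u_2,\ldots$ with $u_{i+1}\in F(u_i)$ for all $i$; a path is a walk all of whose vertices are distinct; the length of a path is the number of its edges. A path emanates from $u$ if its first vertex is $u$. Locally path-bounded: $G$ is locally path-bounded if for every vertex $u\in V$ there is a bound $b(u)\in\mathbb{Z}^0$ (depending on $u$) such that every directed path emanating from $u$ has length at most $b(u)$. mex: for $S\subsetneq\mathbb{Z}^0$, $\operatorname{mex} S=\min(\mathbb{Z}^0\setminus S)$. Notation for a function $\gamma\colon V\to\mathbb{Z}^0\cup\{\infty\}$, where $\infty$ is a symbol regarded as larger than every natural number: $V^f=\{u\in V:\gamma(u)<\infty\}$; for $u\in V$, $\gamma(F(u))=\{\gamma(v):v\in F(u),\ \gamma(v)<\infty\}$ (only finite values are collected); $\gamma'(u)=\operatorname{mex}\gamma(F(u))$.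 If $\gamma(u)=\infty$ and $\gamma(F(u))=K$, one also writes $\gamma(u)=\infty(K)$. Definition ($\gamma$-function, also called the generalized Sprague-Grundy function): $\gamma\colon V\to\mathbb{Z}^0\cup\{\infty\}$ is a $\gamma$-function with counter function $c\colon V^f\to J$, where $J$ is any infinite well-ordered set, if the following three conditions hold (whenever a condition refers to $\gamma'(u)$, it includes the requirement that this mex exists). A. If $\gamma(u)<\infty$, then $\gamma(u)=\gamma'(u)$. B. If there exists $v\in F(u)$ with $\gamma(v)>\gamma(u)$ (so $\gamma(u)<\infty$, and $\gamma(v)=\infty$ is allowed), then there exists $w\in F(v)$ satisfying $\gamma(w)=\gamma(u)$ and $c(w)<c(u)$. (This is required for every such $v$.) C. If $\gamma(u)=\infty$, then there is $v\in F(u)$ with $\gamma(v)=\infty(K)$ (i.e. $\gamma(v)=\infty$ and $K=\gamma(F(v))$) such that $\gamma'(u)\notin K$. The counter function is not required to be unique. *)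

(* Defs.v *)
From Stdlib Require Import List Sorted Relations Wellfounded FinFun.

Set Implicit Arguments.

(* A digraph is a vertex type [V] with an edge relation [E]; the set of
   followers of [u] is [E u]. Loops, cycles and infinitely many vertices or
   followers are allowed. *)

(* [path_from E u p]: the vertices [u :: p] form a path. [Sorted] relates
   consecutive elements only, so [Sorted E (u :: p)] says that [u :: p] is a
   walk. The number of edges is [length p]. *)
Definition path_from (V : Type) (E : relation V) (u : V) (p : list V) : Prop :=
  Sorted E (u :: p) /\ NoDup (u :: p).

(* Finite paths suffice: an infinite path has initial segments of every
   length, so a bound on finite paths excludes it. *)
Definition locally_path_bounded (V : Type) (E : relation V) : Prop :=
  forall u : V, exists b : nat,
    forall p : list V, path_from E u p -> length p <= b.

Definition longest_path_from (V : Type) (E : relation V) (u : V) (p : list V)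
    : Prop :=
  path_from E u p /\
  forall q : list V, path_from E u q -> length q <= length p.

(* Nonnegative integers together with infinity, the latter being [None]. *)
Definition ext : Type := option nat.

Definition ext_lt (x y : ext) : Prop :=
  match x, y with
  | Some m, Some n => m < n
  | Some _, None => True
  | None, _ => False
  end.

(* A relation rather than a function: [S] has no mex when it is all of [nat]. *)
Definition is_mex (S : nat -> Prop) (m : nat) : Prop :=
  ~ S m /\ forall k : nat, ~ S k -> m <= k.

(* The finite values of [gamma] on the followers of [u]. *)
Definition gamma_F (V : Type) (E : relation V) (gamma : V -> ext) (u : V)
    : nat -> Prop :=
  fun n => exists v : V, E u v /\ gamma v = Some n.

Definition Vf (V : Type) (gamma : V -> ext) : Type :=
  {u : V | ext_lt (gamma u) None}.

Definition strict_well_order (J : Type) (lt : relation J) : Prop :=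
  transitive J lt /\
  (forall x y : J, lt x y \/ x = y \/ lt y x) /\
  well_founded lt.

Record is_gamma_function (V : Type) (E : relation V) (gamma : V -> ext)
    (J : Type) (lt : relation J) (c : Vf gamma -> J) : Prop := {
  gamma_condA : forall (u : V) (n : nat),
    gamma u = Some n -> is_mex (gamma_F E gamma u) n;
  (* [ext_lt (gamma u) (gamma v)] forces [gamma u] to be finite, so letting
     [u] range over [Vf gamma] loses nothing. *)
  gamma_condB : forall (u : Vf gamma) (v : V),
    E (proj1_sig u) v -> ext_lt (gamma (proj1_sig u)) (gamma v) ->
    exists w : Vf gamma,
      E v (proj1_sig w) /\
      gamma (proj1_sig w) = gamma (proj1_sig u) /\
      lt (c w) (c u);
  gamma_condC : forall u : V, gamma u = None ->
    exists v : V, E u v /\ gamma v = None /\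
      exists m : nat, is_mex (gamma_F E gamma u) m /\ ~ gamma_F E gamma v m
}.

Definition has_counter_function (V : Type) (E : relation V) (gamma : V -> ext)
    : Prop :=
  exists (J : Type) (lt : relation J) (c : Vf gamma -> J),
    strict_well_order lt /\ ~ Finite J /\ is_gamma_function E lt c.

(* Main.v *)
Require Import Defs.
From Stdlib Require Import List Relations.
From Stdlib Require Import Sorted FinFun Arith Lia Wf_nat.
From Stdlib Require Import Classical ClassicalEpsilon FunctionalExtensionality.

(** Uniqueness holds on every digraph: if two gamma-functions agree about the
    values below [m], then induction on the counter of [u] shows that
    [gamma1 u = m] forces [gamma2 u = m].

    For existence, the vertices of value [m] are, once the smaller values have
    been assigned, a least fixed point: [u] gets value [m] if it has followers of
    all smaller values and every follower of [u] without a smaller value has itself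
    a follower of value [m]. The counter is the stage at which [u] is added. Playing
    against the stages yields a path, so local path-boundedness makes the
    iteration close after finitely many steps, and natural numbers suffice as
    counters. Boundedness is needed once more to see that the mex exists at the
    vertices of value infinity. *)

(** * Least elements, well-orders and paths *)

Lemma least_nat (P : nat -> Prop) :
  (exists n, P n) -> exists n, P n /\ forall k, P k -> n <= k.
Proof.
intros HP.
destruct (dec_inh_nat_subset_has_unique_least_element P) as [n [Hn _]];
  [intros n; apply classic | exact HP | exists n; exact Hn].
Qed.

Lemma is_mex_exists (S : nat -> Prop) (b : nat) :
  (forall n, S n -> n < b) -> exists m, is_mex S m.
Proof.
intros Hb. apply (least_nat (fun n => ~ S n)).
exists b. intros H. apply Hb in H. lia.
Qed.

Lemma nat_not_finite : ~ Finite nat.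
Proof.
intros [l Hl].
pose proof (proj1 (list_max_le l (list_max l)) (le_n _)) as H.
rewrite Forall_forall in H.
specialize (H (S (list_max l)) (Hl _)). lia.
Qed.

Lemma nat_strict_well_order : strict_well_order lt.
Proof.
split; [|split].
- intros x y z; lia.
- intros x y; lia.
- exact lt_wf.
Qed.

Lemma path_from_cons (V : Type) (E : relation V) (u v : V) (p : list V) :
  E u v -> ~ In u (v :: p) -> path_from E v p -> path_from E u (v :: p).
Proof.
intros Huv Hu [Hs Hn]. split; constructor; auto.
Qed.

Lemma path_from_nil (V : Type) (E : relation V) (u : V) : path_from E u nil.
Proof. split; repeat constructor; simpl; tauto. Qed.

(** The least bound is attained, since otherwise its predecessor would also be a bound. *)
Lemma longest_path_exists (V : Type) (E : relation V) (u : V) (b : nat) :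
  (forall p, path_from E u p -> length p <= b) ->
  exists p, longest_path_from E u p.
Proof.
intros Hb.
destruct (least_nat (fun b => forall p, path_from E u p -> length p <= b))
  as [n [Hn Hmin]]; [exists b; exact Hb|].
destruct n as [|n].
- exists nil. split; [apply path_from_nil | exact Hn].
- apply NNPP. intros Hno. specialize (Hmin n).
  enough (S n <= n) by lia. apply Hmin. intros p Hp.
  destruct (le_lt_dec (length p) n) as [|Hlt]; [assumption|].
  exfalso. apply Hno. exists p. split; [exact Hp|].
  intros q Hq. apply Hn in Hq. lia.
Qed.

(** * Consequences of the mex condition *)

Section CondA.
Variables (V : Type) (E : relation V) (gamma : V -> ext).
Hypothesis condA : forall u n, gamma u = Some n -> is_mex (gamma_F E gamma u) n.

Lemma follower_of_smaller_value u n k :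
  gamma u = Some n -> k < n -> exists v, E u v /\ gamma v = Some k.
Proof.
intros Hu Hk. apply NNPP. intros Hno.
destruct (condA _ _ Hu) as [_ Hmin]. specialize (Hmin k Hno). lia.
Qed.

(** By the mex property one can step from each value to the value one lower. The last clause bounds
    the values on the path, so that a vertex of larger or infinite value can be put in front of
    it. *)
Lemma path_of_decreasing_values n u :
  gamma u = Some n ->
  exists p, path_from E u p /\ length p = n /\
    forall x, In x (u :: p) -> exists k, k <= n /\ gamma x = Some k.
Proof.
revert u. induction n as [|n IH]; intros u Hu.
- exists nil. split; [apply path_from_nil|]. split; [reflexivity|].
  intros x [<-|[]]. exists 0. auto.
- destruct (follower_of_smaller_value u (S n) n Hu) as [v [Huv Hv]]; [lia|].
  destruct (IH v Hv) as [p [Hp [Hl Hx]]].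
  exists (v :: p). split; [|split].
  + apply path_from_cons; auto. intros Hin.
    destruct (Hx _ Hin) as [k [Hk Hgk]]. rewrite Hu in Hgk.
    injection Hgk as Hgk. lia.
  + simpl. lia.
  + intros x [<-|Hin]; [exists (S n); auto|].
    destruct (Hx _ Hin) as [k [Hk Hgk]]. exists k. auto.
Qed.

End CondA.

(** * Uniqueness on arbitrary digraphs *)

Section Uniqueness.
Variables (V : Type) (E : relation V).

(** Only the counter of [gamma1] drives the induction; the lemma is used twice, with the roles
    exchanged. *)
Lemma gamma_value_transfer (gamma1 gamma2 : V -> ext)
    (J : Type) (lt : relation J) (c : Vf gamma1 -> J) (m : nat) :
  well_founded lt -> is_gamma_function E lt c ->
  (forall u n, gamma2 u = Some n -> is_mex (gamma_F E gamma2 u) n) ->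
  (forall u, gamma2 u = None -> exists v, E u v /\ gamma2 v = None /\
     exists m, is_mex (gamma_F E gamma2 u) m /\ ~ gamma_F E gamma2 v m) ->
  (forall k, k < m -> forall u, gamma1 u = Some k <-> gamma2 u = Some k) ->
  forall u, gamma1 u = Some m -> gamma2 u = Some m.
Proof.
intros Hwf [A1 B1 _] A2 C2 IHm.
enough (H : forall j (u : Vf gamma1), c u = j ->
    gamma1 (proj1_sig u) = Some m -> gamma2 (proj1_sig u) = Some m).
{ intros u Hu. assert (Hf : ext_lt (gamma1 u) None) by (rewrite Hu; exact I).
  exact (H _ (exist _ u Hf) eq_refl Hu). }
intros j. induction j as [j IHj] using (well_founded_induction Hwf).
intros u Hcu Hu.
(* Such a [v] has [gamma1] above [m], so condition B returns to a [w] with a smaller counter, where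
   [gamma2] is [m] by induction. This rules out followers of [gamma2]-value [m], and later the
   follower that condition C would supply. *)
assert (Hv : forall v, E (proj1_sig u) v -> ~ gamma_F E gamma2 v m ->
    (forall k, gamma2 v = Some k -> m <= k) -> False).
{ intros v Huv Hno Hge.
  assert (Hlt : ext_lt (gamma1 (proj1_sig u)) (gamma1 v)).
  { rewrite Hu. destruct (gamma1 v) as [k|] eqn:Hk; simpl; [|exact I].
    assert (k <> m).
    { intros ->. apply (proj1 (A1 _ _ Hu)). exists v. auto. }
    destruct (le_lt_dec m k); [lia|].
    apply IHm in Hk; [|assumption]. apply Hge in Hk. lia. }
  destruct (B1 u v Huv Hlt) as [w [Hvw [Hw Hc]]].
  apply Hno. exists (proj1_sig w). split; [exact Hvw|].
  rewrite Hcu in Hc. apply (IHj _ Hc w eq_refl). congruence. }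
assert (Hfew : ~ gamma_F E gamma2 (proj1_sig u) m).
{ intros [v [Huv Hgv]]. apply (Hv v Huv).
  - apply (A2 _ _ Hgv).
  - intros k Hk. rewrite Hgv in Hk. injection Hk as ->. lia. }
assert (Hbelow : forall k, k < m -> gamma_F E gamma2 (proj1_sig u) k).
{ intros k Hk.
  destruct (follower_of_smaller_value V E gamma1 A1 _ _ k Hu Hk)
    as [v [Huv Hgv]].
  exists v. split; [exact Huv|]. apply IHm; assumption. }
assert (Hmex : forall n, is_mex (gamma_F E gamma2 (proj1_sig u)) n -> n = m).
{ intros n [Hn Hmin]. specialize (Hmin m Hfew).
  destruct (le_lt_dec m n) as [|Hlt]; [lia|].
  exfalso. apply Hn, Hbelow, Hlt. }
destruct (gamma2 (proj1_sig u)) as [n|] eqn:Hgu.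
- rewrite (Hmex n (A2 _ _ Hgu)). reflexivity.
- destruct (C2 _ Hgu) as [v [Huv [Hgv [n [Hn Hno]]]]].
  apply Hmex in Hn. subst n. exfalso. apply (Hv v Huv Hno). congruence.
Qed.

Lemma gamma_function_unique (gamma1 gamma2 : V -> ext) :
  has_counter_function E gamma1 -> has_counter_function E gamma2 ->
  gamma1 = gamma2.
Proof.
intros [J1 [lt1 [c1 [[_ [_ Hwf1]] [_ H1]]]]] [J2 [lt2 [c2 [[_ [_ Hwf2]] [_ H2]]]]].
assert (H : forall m u, gamma1 u = Some m <-> gamma2 u = Some m).
{ intros m. induction m as [m IHm] using lt_wf_ind. intros u. split.
  - apply (gamma_value_transfer _ _ _ _ _ m Hwf1 H1);
      [apply H2 | apply H2 | exact IHm].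
  - apply (gamma_value_transfer _ _ _ _ _ m Hwf2 H2); [apply H1 | apply H1 |].
    intros k Hk x. symmetry. apply IHm, Hk. }
extensionality u.
destruct (gamma1 u) as [m|] eqn:Hu.
- symmetry. apply H, Hu.
- destruct (gamma2 u) as [m|] eqn:Hu2; [|reflexivity].
  apply H in Hu2. congruence.
Qed.

End Uniqueness.

(** * The fixed point for a single value *)

Section Stages.
Variables (V : Type) (E : relation V) (L B : V -> Prop).

(** These are the iterates, from the empty set, of a monotone operator. In the application [L] holds
    the vertices with smaller values and [B] the candidates for the current one. *)
Fixpoint stage (i : nat) (u : V) : Prop :=
  match i with
  | 0 => False
  | S i => B u /\ forall v, E u v -> ~ L v -> exists w, E v w /\ stage i w
  end.

Definition limit (u : V) : Prop := exists i, stage i u.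

Lemma stage_S i u : stage i u -> stage (S i) u.
Proof.
revert u. induction i as [|i IH]; intros u; [intros []|].
intros [HB H]. split; [exact HB|]. intros v Huv Hv.
destruct (H v Huv Hv) as [w [Hvw Hw]]. exists w. auto.
Qed.

Lemma stage_le i j u : i <= j -> stage i u -> stage j u.
Proof. induction 1; auto using stage_S. Qed.

Lemma limit_base u : limit u -> B u.
Proof. intros [[|i] H]; [destruct H | apply H]. Qed.

Lemma limit_second_follower u v :
  limit u -> E u v -> ~ L v -> exists w, E v w /\ limit w.
Proof.
intros [[|i] H] Huv Hv; [destruct H|].
destruct H as [_ H]. destruct (H v Huv Hv) as [w [Hvw Hw]].
exists w. split; [exact Hvw | exists i; exact Hw].
Qed.

Hypothesis base_not_L : forall u, B u -> ~ L u.

(** Descent on the stage of [u]: the reply [w] to the move [v] has a lower stage, and since [v] is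
    in [limit] too, [w] has in turn a follower in [limit]. *)
Lemma limit_independent u v : limit u -> limit v -> ~ E u v.
Proof.
intros [i Hu]. revert u v Hu. induction i as [|i IH]; intros u v Hu Hv Huv.
- destruct Hu.
- destruct Hu as [_ Hu].
  destruct (Hu v Huv (base_not_L _ (limit_base _ Hv))) as [w [Hvw Hw]].
  assert (Hlw : limit w) by (exists i; exact Hw).
  destruct (limit_second_follower _ _ Hv Hvw (base_not_L _ (limit_base _ Hlw)))
    as [w' [Hww' Hw']].
  exact (IH w w' Hw Hw' Hww').
Qed.

(* The second player moves to the earliest possible stage and the first player
   delays this as long as possible; the resulting walk alternates between
   vertices outside and inside [limit], with strictly decreasing stages. *)
Lemma path_of_decreasing_stages i v w :
  E v w -> stage (S i) w -> (forall x, E v x -> ~ stage i x) ->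
  exists p, path_from E v (w :: p) /\ length p = 2 * i /\
    forall x, In x (v :: w :: p) ->
      stage (S i) x \/ ~ limit x /\ exists y, E x y /\ stage (S i) y.
Proof.
revert v w. induction i as [|i IH]; intros v w Hvw Hw Hv;
  assert (Hlw : limit w) by (eexists; exact Hw);
  assert (Hlv : ~ limit v)
    by (intros Hlv; exact (limit_independent v w Hlv Hlw Hvw)).
- exists nil. split; [|split; [reflexivity|]].
  + apply path_from_cons; auto using path_from_nil.
    intros [<-|[]]. contradiction.
  + intros x [<-|[<-|[]]]; eauto.
(* [w] is not yet in [stage (S i)], so some move from it has no reply in [stage i]. *)
- assert (Hstep : exists v', E w v' /\ ~ L v' /\ forall x, E v' x -> ~ stage i x).
  { apply NNPP. intros Hno. apply (Hv w Hvw).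
    split; [apply limit_base, Hlw|].
    intros v' Hwv' Hv'. apply NNPP. intros Hno'. apply Hno.
    exists v'. repeat split; auto. intros x Hx Hsx. apply Hno'. eauto. }
  destruct Hstep as [v' [Hwv' [Hv' Hno]]].
  destruct Hw as [HB Hw]. destruct (Hw v' Hwv' Hv') as [w' [Hvw' Hw']].
  destruct (IH v' w' Hvw' Hw' Hno) as [p [Hp [Hl Hx]]].
  (* Vertices of the inner path are in [stage (S i)], or outside [limit] with a follower in
     [stage (S i)]. Neither fits [w], which is in [limit] but not in that stage, nor [v], which is
     outside [limit] and has no such follower. *)
  assert (Hwnot : ~ In w (v' :: w' :: p)).
  { intros Hin. destruct (Hx _ Hin) as [H|[H _]]; [|contradiction].
    exact (Hv w Hvw H). }
  assert (Hvnot : ~ In v (w :: v' :: w' :: p)).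
  { intros [<-|Hin]; [contradiction|].
    destruct (Hx _ Hin) as [H|[_ [y [Hy H]]]].
    - apply Hlv. eexists. exact H.
    - exact (Hv y Hy H). }
  exists (v' :: w' :: p). split; [|split].
  + auto using path_from_cons.
  + simpl. lia.
  + intros x [<-|[<-|Hin]].
    * right. split; [exact Hlv|]. exists w. split; [exact Hvw|]. split; assumption.
    * left. split; assumption.
    * destruct (Hx _ Hin) as [H|[H [y [Hy H']]]]; [left|right];
        eauto using stage_S.
Qed.

Hypothesis HG : locally_path_bounded E.

(** With infinitely many followers the replies could have unbounded stages. A reply first available
    after stage [b] would, however, force a path from [u] of length [2 * i + 2] with [b <= i]. *)
Lemma limit_closed u :
  B u -> (forall v, E u v -> ~ L v -> exists w, E v w /\ limit w) -> limit u.
Proof.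
intros HB Hu. apply NNPP. intros Hlu.
(* This keeps [u] off the path built below, whose vertices outside [limit] all have followers in
   [limit]. *)
assert (Hind : forall x, E u x -> ~ limit x).
{ intros x Hux Hx.
  destruct (Hu x Hux (base_not_L _ (limit_base _ Hx))) as [y [Hxy Hy]].
  exact (limit_independent x y Hx Hy Hxy). }
destruct (HG u) as [b Hb].
assert (Hstep : exists v, E u v /\ ~ L v /\ forall x, E v x -> ~ stage b x).
{ apply NNPP. intros Hno. apply Hlu. exists (S b). split; [exact HB|].
  intros v Huv Hv. apply NNPP. intros Hno'. apply Hno.
  exists v. repeat split; auto. intros x Hx Hsx. apply Hno'. eauto. }
destruct Hstep as [v [Huv [Hv Hno]]].
destruct (least_nat (fun i => exists w, E v w /\ stage i w))
  as [i [[w [Hvw Hw]] Hmin]].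
{ destruct (Hu v Huv Hv) as [w [Hvw [i Hi]]]. eauto. }
destruct i as [|i]; [destruct Hw|].
assert (b <= i).
{ destruct (le_lt_dec b i) as [|Hlt]; [assumption|].
  exfalso. apply (Hno w Hvw). apply (stage_le (S i)); [lia | exact Hw]. }
destruct (path_of_decreasing_stages i v w Hvw Hw) as [p [Hp [Hl Hx]]].
{ intros x Hvx Hsx. enough (S i <= i) by lia. apply Hmin. eauto. }
enough (Hup : path_from E u (v :: w :: p)).
{ apply Hb in Hup. simpl in Hup. lia. }
apply path_from_cons; auto.
intros Hin. destruct (Hx _ Hin) as [H'|[_ [y [Hy H']]]].
- apply Hlu. eexists. exact H'.
- apply (Hind y Hy). eexists. exact H'.
Qed.

End Stages.

(** * Assembling the values into a gamma-function *)

Section Existence.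
Variables (V : Type) (E : relation V).

Definition assigned (R : V -> nat -> Prop) (u : V) : Prop := exists k, R u k.

Definition eligible (R : V -> nat -> Prop) (m : nat) (u : V) : Prop :=
  ~ assigned R u /\ forall k, k < m -> exists v, E u v /\ R v k.

(* Level [m] needs all lower levels, not only the preceding one: collecting them
   in one relation makes the recursion structural. *)
Fixpoint value_below (m : nat) (u : V) (k : nat) : Prop :=
  match m with
  | 0 => False
  | S m => value_below m u k \/ k = m /\
      limit V E (assigned (value_below m)) (eligible (value_below m) m) u
  end.

Definition value_stage (m : nat) : nat -> V -> Prop :=
  stage V E (assigned (value_below m)) (eligible (value_below m) m).

Definition has_value (u : V) (m : nat) : Prop := exists i, value_stage m i u.

Lemma value_below_iff m u k : value_below m u k <-> k < m /\ has_value u k.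
Proof.
induction m as [|m IH]; simpl; [split; [tauto | lia]|].
rewrite IH. split.
- intros [[Hk H]|[-> H]]; split; auto; lia.
- intros [Hk H]. destruct (Nat.eq_dec k m) as [->|Hne]; [right; auto|].
  left. split; [lia | exact H].
Qed.

Lemma eligible_not_assigned R m u : eligible R m u -> ~ assigned R u.
Proof. intros [H _]. exact H. Qed.

Lemma has_value_eligible u m : has_value u m -> eligible (value_below m) m u.
Proof. apply limit_base. Qed.

(** Eligibility for the larger value excludes vertices that already have the smaller one. *)
Lemma has_value_fun u m n : has_value u m -> has_value u n -> m = n.
Proof.
assert (H : forall m n, has_value u m -> has_value u n -> ~ m < n).
{ intros i j Hi Hj Hlt. apply (proj1 (has_value_eligible _ _ Hj)).
  exists i. apply value_below_iff. auto. }
intros Hm Hn. specialize (H m n Hm Hn) as H1. specialize (H n m Hn Hm). lia.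
Qed.

Lemma has_value_smaller u m k :
  has_value u m -> k < m -> exists v, E u v /\ has_value v k.
Proof.
intros Hu Hk. destruct (has_value_eligible _ _ Hu) as [_ H].
destruct (H k Hk) as [v [Huv Hv]]. exists v. split; [exact Huv|].
apply value_below_iff in Hv. apply Hv.
Qed.

Lemma has_value_independent u v m : has_value u m -> has_value v m -> ~ E u v.
Proof. apply limit_independent, eligible_not_assigned. Qed.

Lemma gamma_function_exists :
  locally_path_bounded E -> exists gamma, has_counter_function E gamma.
Proof.
intros HG.
pose (spec := fun u (x : ext) => match x with
  | Some m => has_value u m | None => forall m, ~ has_value u m end).
pose (gamma := fun u => epsilon (inhabits None) (spec u)).
assert (Hspec : forall u, spec u (gamma u)).
{ intros u. apply epsilon_spec.
  destruct (classic (exists m, has_value u m)) as [[m Hm]|Hno].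
  - exists (Some m). exact Hm.
  - exists None. intros m Hm. eauto. }
assert (Hgamma : forall u m, gamma u = Some m <-> has_value u m).
{ intros u m. specialize (Hspec u). unfold spec in Hspec.
  destruct (gamma u) as [n|]; split; intros H.
  - injection H as <-. exact Hspec.
  - f_equal. exact (has_value_fun _ _ _ Hspec H).
  - discriminate.
  - exfalso. exact (Hspec m H). }
clearbody gamma. clear spec Hspec.
(* The counter is the least stage containing [u]; as values are unique, at most one [m] matters. *)
pose (first := fun u i => forall m, has_value u m ->
  value_stage m i u /\ forall j, value_stage m j u -> i <= j).
pose (c := fun u : Vf gamma => epsilon (inhabits 0) (first (proj1_sig u))).
assert (Hc : forall u : Vf gamma, first (proj1_sig u) (c u)).
{ intros [u Hu]. apply epsilon_spec. simpl.
  destruct (gamma u) as [m|] eqn:Hgu; [|destruct Hu].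
  apply Hgamma in Hgu. destruct (least_nat _ Hgu) as [i Hi].
  exists i. intros n Hn. rewrite <- (has_value_fun _ _ _ Hgu Hn). exact Hi. }
clearbody c.
assert (A : forall u n, gamma u = Some n -> is_mex (gamma_F E gamma u) n).
{ intros u n Hu. apply Hgamma in Hu. split.
  - intros [v [Huv Hv]]. apply Hgamma in Hv.
    exact (has_value_independent _ _ _ Hu Hv Huv).
  - intros k Hk. destruct (le_lt_dec n k) as [|Hlt]; [assumption|].
    exfalso. apply Hk. destruct (has_value_smaller _ _ _ Hu Hlt) as [v [Huv Hv]].
    exists v. split; [exact Huv|]. apply Hgamma, Hv. }
exists gamma, nat, lt, c.
split; [exact nat_strict_well_order|]. split; [exact nat_not_finite|].
split; [exact A| |].
- intros u v Huv Hlt. destruct (gamma (proj1_sig u)) as [m|] eqn:Hu;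
    [|destruct Hlt].
  apply Hgamma in Hu. destruct (Hc u m Hu) as [Hst _].
  (* Stage 0 is empty, so the counter is some [S i]; the reply lies in stage [i], hence its counter
     is at most [i]. *)
  destruct (c u) as [|i]; [destruct Hst|]. destruct Hst as [_ Hst].
  destruct (Hst v Huv) as [w [Hvw Hw]].
  { intros [k Hk]. apply value_below_iff in Hk. destruct Hk as [Hk Hv].
    apply Hgamma in Hv. rewrite Hv in Hlt. simpl in Hlt. lia. }
  assert (Hgw : has_value w m) by (exists i; exact Hw).
  assert (Hf : ext_lt (gamma w) None)
    by (rewrite (proj2 (Hgamma w m) Hgw); exact I).
  exists (exist _ w Hf). split; [exact Hvw|]. split; [apply Hgamma, Hgw|].
  destruct (Hc (exist _ w Hf) m Hgw) as [_ Hmin]. specialize (Hmin i Hw). lia.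
- intros u Hu.
  assert (Hnone : forall m, ~ has_value u m).
  { intros m Hm. apply Hgamma in Hm. congruence. }
  destruct (HG u) as [b Hb].
  destruct (is_mex_exists (gamma_F E gamma u) b) as [m Hm].
  (* The values decrease along the path from [v], so it cannot return to [u]. *)
  { intros n [v [Huv Hv]].
    destruct (path_of_decreasing_values V E gamma A n v Hv) as [p [Hp [Hl Hx]]].
    enough (Hup : path_from E u (v :: p)) by (apply Hb in Hup; simpl in Hup; lia).
    apply path_from_cons; auto. intros Hin.
    destruct (Hx _ Hin) as [k [_ Hk]]. congruence. }
  (* Since [m] is the mex, [u] is eligible for it; without such a [v], closure of the fixed point
     would give [u] the value [m]. *)
  assert (Hv : exists v, E u v /\ ~ assigned (value_below m) v /\
      ~ exists w, E v w /\ has_value w m).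
  { apply NNPP. intros Hno. apply (Hnone m).
    apply limit_closed; [apply eligible_not_assigned | exact HG | |].
    - split.
      + intros [k Hk]. apply value_below_iff in Hk. exact (Hnone k (proj2 Hk)).
      + intros k Hk.
        assert (HF : gamma_F E gamma u k).
        { apply NNPP. intros Hk'. apply (proj2 Hm) in Hk'. lia. }
        destruct HF as [v [Huv Hv]]. exists v. split; [exact Huv|].
        apply value_below_iff. split; [exact Hk|]. apply Hgamma, Hv.
    - intros v Huv Hv. apply NNPP. intros Hno'. apply Hno. eauto. }
  destruct Hv as [v [Huv [Hv Hno]]].
  exists v. split; [exact Huv|]. split.
  (* A value of [v] below [m] contradicts its choice, [m] itself contradicts the mex at [u], and a
     larger one would give [v] a follower of value [m]. *)
  + destruct (gamma v) as [n|] eqn:Hgv; [exfalso|reflexivity].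
    assert (Hvn : has_value v n) by (apply Hgamma, Hgv).
    destruct (Nat.lt_trichotomy n m) as [Hlt|[->|Hlt]].
    * apply Hv. exists n. apply value_below_iff. auto.
    * apply (proj1 Hm). exists v. auto.
    * apply Hno. exact (has_value_smaller _ _ _ Hvn Hlt).
  + exists m. split; [exact Hm|]. intros [w [Hvw Hw]].
    apply Hno. exists w. split; [exact Hvw|]. apply Hgamma, Hw.
Qed.

End Existence.

Theorem theorem1 (V : Type) (E : relation V) (HG : locally_path_bounded E) :
  (exists! gamma : V -> ext, has_counter_function E gamma) /\
  (forall gamma : V -> ext, has_counter_function E gamma ->
     forall (u : V) (n : nat), gamma u = Some n ->
       exists p : list V, longest_path_from E u p /\ n <= length p).
Proof.
split.
- destruct (gamma_function_exists V E HG) as [gamma Hgamma].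
  exists gamma. split; [exact Hgamma|].
  intros gamma' Hgamma'. exact (gamma_function_unique V E _ _ Hgamma Hgamma').
- intros gamma [J [lt [c [_ [_ [A _ _]]]]]] u n Hu.
  destruct (HG u) as [b Hb].
  destruct (longest_path_exists V E u b Hb) as [p Hp].
  exists p. split; [exact Hp|].
  destruct (path_of_decreasing_values V E gamma A n u Hu) as [q [Hq [<- _]]].
  apply Hp, Hq.
Qed.
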